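(* Let $P$ be a poset on $[n]$. There is a bijection $\Phi:\mathfrak{S}^{\pitchfork}(P)\to\mathcal{L}(P)$ such that $\operatorname{cyc}(\tau)={\sf LRmax}_P(\Phi(\tau))$ for all $\tau\in\mathfrak{S}^{\pitchfork}(P)$. Consequently \[ {\sf Poin}(P,t)=\sum_{\sigma\in\mathcal{L}(P)} t^{\,n-{\sf LRmax}_P(\sigma)}. \]
   Context: Braid arrangement: in $V=\mathbb{R}^n$ let $H_{ij}=\{x: x_i=x_j\}$, $1\le i<j\le n$; $\mathcal{L}$ is the set of intersections of subsets of these hyperplanes ($V$ included), ordered by reverse inclusion, with Möbius function $\mu$. For a poset $P$ on $[n]$, $\mathcal{K}_P=\{x: x_i<x_j \text{ whenever } i<_P j\}$, $\mathcal{L}^{int}(\mathcal{K}_P)=\{X\in\mathcal{L}:X\cap\mathcal{K}_P\ne\emptyset\}$, $c_k(P)=\sum_{X\in\mathcal{L}^{int}(\mathcal{K}_P),\operatorname{codim}X=k}|\mu(V,X)|$, ${\sf Poin}(P,t)=\sum_k c_k(P)t^k$. $\mathcal{L}(P)$ is the set of linear extensions of $P$: permutations $\sigma=[\sigma_1,\dots,\sigma_n]$ of $[n]$ with $i<_P j$ implying $i$ appears before $j$. For a set partition $\pi$ of $[n]$, $P/\pi$ is the preposet on blocks obtained as transitive closure of $B\le B'$ whenever $p\le_P q$ for some $p\in B,q\in B'$; $\pi$ is $P$-transverse if its blocks are antichains of $P$ and $P/\pi$ is a poset. $\mathfrak{S}^{\pitchfork}(P)$ is the set of permutations of $[n]$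 whose cycle partition is $P$-transverse; $\operatorname{cyc}(\tau)$ is the number of cycles. For $\sigma\in\mathcal{L}(P)$: Level 1 consists of the entries of the longest initial segment $\sigma_1,\dots,\sigma_r$ forming an antichain of $P$; recursively, if Levels $1,\dots,k-1$ consist of $\sigma_1,\dots,\sigma_t$, Level $k$ consists of the entries of the longest initial segment of $\sigma_{t+1},\dots,\sigma_n$ forming an antichain of $P$. All Level 1 entries are essential; an entry $x$ of Level $k\ge 2$ is essential if $x>_P y$ for some $y$ of Level $k-1$. An entry $x$ of Level $k$ is a $P$-left-to-right maximum if it is essential and, in the subsequence (in the order of $\sigma$) of essential entries of Level $k$, $x$ is larger (as an integer) than all essential Level $k$ entries preceding it. ${\sf LRmax}_P(\sigma)$ is the number of $P$-left-to-right maxima of $\sigma$. *)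

(* Defs.v *)
From HB Require Import structures.
From mathcomp Require Import all_boot all_order all_fingroup all_algebra.
From mathcomp Require Import finmap.
From mathcomp Require Import boolp classical_sets reals.

Set Implicit Arguments.
Unset Strict Implicit.
Unset Printing Implicit Defensive.

Import Order.TTheory GRing.Theory Num.Theory.

Local Open Scope ring_scope.
Local Open Scope fset_scope.

Section Mobius.

Variables (T : choiceType) (le : rel T) (L : {fset T}).

Fixpoint mobius_rec (m : nat) (x y : T) : int :=
  if x == y then 1 else
  if m isn't m'.+1 then 0 else
  if le x y then
    - \sum_(z <- L | [&& le x z, le z y & z != y]) mobius_rec m' x z
  else 0.

(* The fuel #|` L| exceeds the length of every chain below an element of L, so
   mobius is the Möbius function of (L, le): see mobiusE. *)
Definition mobius (x y : T) : int := mobius_rec #|` L| x y.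

Lemma mobius_rec_fuel (le_anti : antisymmetric le) (le_trans : transitive le)
    m1 m2 x y :
  (count (fun z => le z y && (z != y)) L <= m1)%N ->
  (count (fun z => le z y && (z != y)) L <= m2)%N ->
  mobius_rec m1 x y = mobius_rec m2 x y.
Proof.
elim: m1 m2 y => [|m1 IH] [|m2] y h1 h2 //=; case: (x == y) => //.
- case: (le x y) => //; rewrite big_seq_cond big_pred0 ?oppr0 // => z.
  apply/negP => /and4P[zL _ zy zNy].
  move: h1; rewrite leqNgt -has_count => /hasP[]; exists z => //.
  by rewrite zy.
- case: (le x y) => //; rewrite big_seq_cond big_pred0 ?oppr0 // => z.
  apply/negP => /and4P[zL _ zy zNy].
  move: h2; rewrite leqNgt -has_count => /hasP[]; exists z => //.
  by rewrite zy.
- case: (le x y) => //; congr (- _).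
  rewrite big_seq_cond [RHS]big_seq_cond.
  apply: eq_bigr => z /and4P[zL _ zy zNy].
  have lt_count : (count (fun w => le w z && (w != z)) L <
                   count (fun w => le w y && (w != y)) L)%N.
    have := count_predUI (fun w => le w z && (w != z)) (pred1 z) L.
    rewrite (count_uniq_mem _ (fset_uniq L)) zL addn1.
    rewrite [count (predI _ _) _](_ : _ = 0%N) ?addn0; last first.
      apply/eqP; rewrite -leqn0 leqNgt -has_count; apply/hasPn => w _ /=.
      by case: eqP => //; rewrite !andbF.
    move=> <-; apply: sub_count => w /= /orP[/andP[wz wNz]|/eqP-> ].
      rewrite (le_trans _ _ _ wz zy) /=; apply: contraNneq wNz => wy.
      by apply/eqP/le_anti; rewrite wz wy zy.
    by rewrite zy zNy.
  by apply: IH; rewrite -ltnS; apply: leq_trans lt_count _.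
Qed.

Lemma mobiusE (le_anti : antisymmetric le) (le_trans : transitive le)
    x y : y \in L ->
  mobius x y =
    if x == y then 1 else
    if le x y then - \sum_(z <- L | [&& le x z, le z y & z != y]) mobius x z
    else 0.
Proof.
move=> yL; rewrite /mobius.
have lt_fuel z : z \in L -> (count (fun w => le w z && (w != z)) L < #|` L|)%N.
  move=> zL; rewrite -(count_predC (fun w => le w z && (w != z)) L).
  rewrite -[X in (X < _)%N]addn0 ltn_add2l -has_count; apply/hasP.
  by exists z => //=; rewrite eqxx andbF.
have -> : mobius_rec #|` L| x y = mobius_rec #|` L|.+1 x y.
  apply: mobius_rec_fuel => //; first exact/ltnW/lt_fuel.
  by apply/ltnW; apply: leq_trans (lt_fuel _ yL) _.
by [].
Qed.

End Mobius.

Section BraidArrangement.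

Variables (R : realType) (n : nat).

Definition hyperplane (i j : 'I_n) : {vspace 'rV[R]_n} :=
  lker (linfun (fun x : 'rV[R]_n => (x 0 i - x 0 j : R^o))).

Lemma memv_hyperplane i j (x : 'rV[R]_n) :
  (x \in hyperplane i j) = (x 0 i == x 0 j).
Proof.
pose f := fun x : 'rV[R]_n => (x 0 i - x 0 j : R^o).
have lin_f : linear f.
  by move=> a u v; rewrite /f !mxE scalerBr addrACA opprD.
pose F : {linear 'rV[R]_n -> R^o} :=
  HB.pack f (GRing.isLinear.Build R 'rV[R]_n R^o *:%R f lin_f).
by rewrite memv_ker -[linfun _]/(linfun F) lfunE /= /f subr_eq0.
Qed.

Definition braid : {fset {vspace 'rV[R]_n}} :=
  [fset hyperplane p.1 p.2 | p in [set p : 'I_n * 'I_n | (p.1 < p.2)%N]].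

(* The intersection of the empty subset is the whole space. *)
Definition flats : {fset {vspace 'rV[R]_n}} :=
  [fset (\bigcap_(H <- (B : {fset {vspace 'rV[R]_n}})) H)%VS
     | B in fpowerset braid].

Definition flat_le (X Y : {vspace 'rV[R]_n}) : bool := (Y <= X)%VS.

Definition codim (X : {vspace 'rV[R]_n}) : nat := (n - \dim X)%N.

End BraidArrangement.

(* From here on, [le] is the (reflexive) order of a poset P on [n], realised
   as 'I_n = {0, ..., n-1}. *)

Definition slt n (le : rel 'I_n) : rel 'I_n := fun i j => (i != j) && le i j.

Section Poincare.

Variables (R : realType) (n : nat) (le : rel 'I_n).

Definition cone : set 'rV[R]_n :=
  [set x : 'rV[R]_n | forall i j : 'I_n, slt le i j -> x 0 i < x 0 j]%classic.

Definition interior_flats : {fset {vspace 'rV[R]_n}} :=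
  [fset X in flats R n | `[< ([set` X] `&` cone !=set0)%classic >]].

Definition whitney (k : nat) : int :=
  \sum_(X <- interior_flats | codim X == k)
    `|mobius (@flat_le R n) (flats R n) fullv X|.

Definition Poin : {poly int} := \sum_(k < n.+1) whitney k *: 'X^k.

End Poincare.

Section Permutations.

Variables (n : nat) (le : rel 'I_n).

Definition antichain (B : {pred 'I_n}) : bool :=
  [forall x in B, forall y in B, (x != y) ==> ~~ le x y].

Definition block_rel (p : {set {set 'I_n}}) : rel {set 'I_n} :=
  fun B C => [&& B \in p, C \in p & [exists x in B, exists y in C, le x y]].

(* [connect] is the reflexive-transitive closure; on the (nonempty) blocks of
   a partition, reflexivity of [le] already makes [block_rel] reflexive. *)
Definition quotient_le (p : {set {set 'I_n}}) : rel {set 'I_n} :=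
  connect (block_rel p).

Definition transverse (p : {set {set 'I_n}}) : bool :=
  [forall B in p, antichain [in B]] &&
  [forall B in p, forall C in p,
     quotient_le p B C && quotient_le p C B ==> (B == C)].

(* [porbits t] is the cycle partition of t, fixed points included. *)
Definition transverse_perms : {set 'S_n} :=
  [set t : 'S_n | transverse (porbits t)].

Definition cyc (t : 'S_n) : nat := #|porbits t|.

(* [s : 'S_n] stands for the word [s 0, ..., s (n-1)], so that the position
   of the entry i is (s^-1) i. *)
Definition linear_extensions : {set 'S_n} :=
  [set s : 'S_n | [forall i, forall j,
     slt le i j ==> ((s^-1)%g i < (s^-1)%g j)%N]].

Definition word (s : 'S_n) : seq 'I_n := [seq s k | k <- enum 'I_n].

Definition antichain_prefix (w : seq 'I_n) : nat :=
  \max_(r < (size w).+1 | antichain [in take r w]) r.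

Fixpoint levels_rec (m : nat) (w : seq 'I_n) : seq (seq 'I_n) :=
  if m isn't m'.+1 then [::] else
  if w is [::] then [::] else
  let r := antichain_prefix w in take r w :: levels_rec m' (drop r w).

(* The fuel suffices because singletons are antichains: see flatten_levels.
   Levels are numbered from 0 here: entry 0 is Level 1. *)
Definition levels (w : seq 'I_n) : seq (seq 'I_n) := levels_rec (size w) w.

Lemma antichain_prefix_gt0 w : w != [::] -> (0 < antichain_prefix w)%N.
Proof.
case: w => // a w _; rewrite /antichain_prefix.
have lt1 : (1 < (size (a :: w)).+1)%N by [].
apply: (@leq_trans (Ordinal lt1)) => //.
apply: (leq_bigmax_cond (F := @nat_of_ord _)).
apply/forall_inP => x /=; rewrite take0 inE => /eqP->.
by apply/forall_inP => y; rewrite inE => /eqP->; rewrite eqxx.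
Qed.

Lemma flatten_levels w : flatten (levels w) = w.
Proof.
rewrite /levels; move: {2}(size w) (leqnn (size w)) => m.
suff H k v : (size v <= k)%N -> flatten (levels_rec k v) = v.
  by move=> _; exact: H.
elim: k v => [|k IH] [|a v] // sv.
rewrite [levels_rec _ _]/= -/(antichain_prefix (a :: v)).
set r := antichain_prefix _.
have r0 : (0 < r)%N by exact: antichain_prefix_gt0.
rewrite [flatten _]/= IH ?cat_take_drop // size_drop.
by rewrite leq_subLR (leq_trans sv) // -add1n leq_add2r.
Qed.

Definition essential (ls : seq (seq 'I_n)) (k : nat) : seq 'I_n :=
  if k is k'.+1 then
    [seq x <- nth [::] ls k | has (fun y => slt le y x) (nth [::] ls k')]
  else nth [::] ls 0.

Definition lrmaxima (w : seq 'I_n) : seq 'I_n :=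
  [seq x : 'I_n <- w | all (fun y : 'I_n => (y < x)%N) (take (index x w) w)].

Definition LRmax (s : 'S_n) : nat :=
  let ls := levels (word s) in
  (\sum_(k < size ls) size (lrmaxima (essential ls k)))%N.

End Permutations.

(* Main.v *)
(* The bijection sends a transverse permutation t to a word as follows.  The
   cycles of t form a poset; give each cycle its level there, the length of a
   longest chain below it.  An entry of positive level is essential if it is
   greater in P than some entry one level below, and every cycle has essential
   entries.  Write each cycle starting with its largest essential entry, and
   list the cycles by increasing level and, within a level, by increasing first
   entry.  As in Foata's correspondence, the first entries of the cycles are
   then exactly the P-left-to-right maxima, and cutting the word before each of
   these recovers the cycles.

   For the Poincare polynomial, the sum of the signs of the permutations fixing
   a flat X pointwise vanishes unless X = V, since a hyperplane containing X
   provides a transposition; hence mu(V, X) is the sum of the signs of the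
   permutations whose fixed space is X.  These all have sign (-1)^codim X, and
   the fixed space of t meets the cone exactly when t is transverse. *)
Require Import Defs.
From mathcomp Require Import all_boot all_order all_fingroup all_algebra.
From mathcomp Require Import finmap boolp classical_sets reals.
From mathcomp Require Import zify.

Set Implicit Arguments.
Unset Strict Implicit.
Unset Printing Implicit Defensive.

(** * Levels of a word *)

Lemma take_index_filter (T : eqType) (p : pred T) (s : seq T) (x : T) : p x ->
  take (index x (filter p s)) (filter p s) = filter p (take (index x s) s).
Proof.
move=> px; elim: s => //= y s IH; case: (eqVneq y x) => [->|yx].
  by rewrite px /= eqxx.
by case: ifP => py /=; rewrite ?py ?(negPf yx) /= IH.
Qed.

Lemma take_index_cat (T : eqType) (u v : seq T) (x : T) : x \notin u ->
  take (index x (u ++ x :: v)) (u ++ x :: v) = u.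
Proof.
by move=> xu; rewrite index_cat (negPf xu) /= eqxx addn0 take_size_cat.
Qed.

Lemma filter_sorted_cat (T : eqType) (f : T -> nat) (k : nat) (w : seq T) :
  pairwise (relpre f leq) w -> all (fun x => k <= f x) w ->
  w = [seq x <- w | f x == k] ++ [seq x <- w | k < f x].
Proof.
elim: w => //= x w IH /andP[/allP xw sw] /andP[kx kw].
rewrite leq_eqVlt eq_sym in kx; case: (eqVneq (f x) k) kx => /= [fx _|_ kx].
  by rewrite ltnNge fx leqnn /= -IH.
have kw' : all (fun y => k < f y) w.
  by apply/allP => y /xw; apply: leq_trans.
rewrite kx (all_filterP kw') (@eq_in_filter _ _ pred0) ?filter_pred0 // => y.
move=> /(allP kw') /=.
by rewrite ltn_neqAle eq_sym => /andP[/negPf->].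
Qed.

Lemma uniq_flatten (T : eqType) (ss : seq (seq T)) :
  all uniq ss -> pairwise (fun a b => ~~ has (mem a) b) ss -> uniq (flatten ss).
Proof.
elim: ss => //= a ss IH /andP[ua us] /andP[/allP Ha ps].
rewrite cat_uniq ua IH //= andbT; apply/hasPn => y /flattenP[b /Ha].
by move/hasPn => h /h.
Qed.

Section Words.
Variables (n : nat) (le : rel 'I_n).
Implicit Types (f : 'I_n -> nat) (w : seq 'I_n).

(** Any prefix longer than [u] contains both the first entry of [v] and the entry of [u] below
    it. *)
Lemma antichain_prefix_cat u v :
  antichain le [in u] ->
  (if v is x :: _ then exists2 y, y \in u & slt le y x else True) ->
  antichain_prefix le (u ++ v) = size u.
Proof.
move=> au hv; apply/eqP; rewrite eqn_leq; apply/andP; split.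
  apply/bigmax_leqP => -[r rs] /= ar; rewrite leqNgt; apply/negP => ur.
  case: v hv rs ar => [_|x v [y yu /andP[yx lyx]]] rs ar.
    by move: rs ur; rewrite cats0; lia.
  have mx : x \in take r (u ++ x :: v).
    rewrite take_cat ltnNge ltnW //= mem_cat.
    by case: (r - size u) (subn_gt0 (size u) r); rewrite ur // => k;
      rewrite inE eqxx orbT.
  have my : y \in take r (u ++ x :: v).
    by rewrite take_cat ltnNge ltnW //= mem_cat yu.
  by move/forall_inP: ar => /(_ y my)/forall_inP/(_ x mx); rewrite yx lyx.
have us : size u < (size (u ++ v)).+1 by rewrite size_cat; lia.
apply: (@leq_trans (Ordinal us)) => //.
apply: (leq_bigmax_cond (F := @nat_of_ord _)).
by rewrite /= take_size_cat.
Qed.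

(* [w] is written level by level, with levels [f] numbered from [k]; the last
   clause says that no level can be extended by the first entry of the next. *)
Definition graded f k w :=
  [/\ pairwise (relpre f leq) w, all (fun x => k <= f x) w,
      (if w is x :: _ then f x == k else true),
      {in w &, forall x y, slt le x y -> f x < f y} &
      forall j x u, k <= j -> [seq z <- w | f z == j.+1] = x :: u ->
        exists2 y, y \in w & (f y == j) && slt le y x].

(** One round of the greedy recursion. The first entry of [v] has level exactly [k.+1]: the last
    clause of [graded] gives an entry one level lower, and this cannot lie in [v], whose levels
    increase weakly. *)
Lemma graded_drop f k w : graded f k w ->
  let v := [seq x <- w | k < f x] in
  graded f k.+1 v /\
  (if v is x :: _ then exists2 y, y \in [seq x <- w | f x == k] & slt le y x
   else True).
Proof.
case=> sw kw hw mw ew v.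
have fv j : k < j -> [seq z <- v | f z == j] = [seq z <- w | f z == j].
  move=> kj; rewrite -filter_predI; apply: eq_filter => z /=.
  by case: eqP => // ->.
have sv : pairwise (relpre f leq) v by rewrite pairwise_filter.
have hv : if v is x :: _ then
    f x == k.+1 /\ exists2 y, y \in [seq x <- w | f x == k] & slt le y x
  else True.
  case def_v: v => [//|x u].
  have xv : x \in v by rewrite def_v inE eqxx.
  have kx : k < f x by move: xv; rewrite mem_filter => /andP[].
  have [||y yw /andP[/eqP fy yx]] := ew (f x).-1 x [seq z <- u | f z == f x].
  - by lia.
  - by rewrite prednK ?(leq_ltn_trans _ kx) // -fv // def_v /= eqxx.
  have yk : f y = k.
    have := allP kw y yw; rewrite leq_eqVlt => /orP[/eqP //|ky].
    have : y \in v by rewrite mem_filter ky.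
    move: sv; rewrite def_v inE /= => /andP[/allP su _] /orP[/eqP yex|/su /=].
      by move: fy; rewrite yex; lia.
    by lia.
  split; first by apply/eqP; lia.
  by exists y => //; rewrite mem_filter yk eqxx.
split; last by case: (v) hv => // x u [].
split=> //.
- by apply/allP => x; rewrite mem_filter => /andP[].
- by case: (v) hv => // x u [].
- by move=> x y; rewrite !mem_filter => /andP[_ xw] /andP[_ yw]; apply: mw.
move=> j x u kj; rewrite fv ?ltnS 1?ltnW // => /ew[]; first exact: ltnW.
by move=> y yw /andP[/eqP fy yx]; exists y; rewrite ?mem_filter ?fy ?kj ?eqxx.
Qed.

(** By [graded_drop] and [antichain_prefix_cat], each greedy cut falls where [f] jumps, so the
    levels are the fibres of [f]. *)
Lemma levels_rec_graded f k w m : graded f k w -> size w <= m ->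
  exists d, all (fun x => f x < k + d) w /\
    levels_rec le m w = [seq [seq x <- w | f x == j] | j <- iota k d].
Proof.
elim: m k w => [|m IH] k [|a w] gw sz //; try by exists 0.
have [gv hv] := graded_drop gw.
case: (gw) => sw kw hw mw ew.
set w' := a :: w in gw sz gv hv sw kw hw mw ew *.
have Ew := filter_sorted_cat sw kw.
set u := [seq x <- w' | f x == k] in Ew hv.
set v := [seq x <- w' | k < f x] in Ew hv gv.
have apu : antichain_prefix le w' = size u.
  rewrite Ew; apply: antichain_prefix_cat => //.
  apply/forall_inP => x; rewrite /= mem_filter => /andP[/eqP fx xw].
  apply/forall_inP => y; rewrite /= mem_filter => /andP[/eqP fy yw].
  apply/implyP => xy; apply/negP => lxy.
  by have := mw x y xw yw; rewrite /slt xy lxy fx fy ltnn => /(_ isT).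
have u0 : 0 < size u by rewrite /u /= hw.
have [|d [vd Ed]] := IH k.+1 v gv.
  rewrite -ltnS (leq_trans _ sz) // [leqRHS](congr1 size Ew) size_cat.
  by rewrite -[leqLHS]add1n leq_add2r.
exists d.+1; split.
  apply/allP => x; rewrite {1}Ew mem_cat => /orP[|/(allP vd)]; last by lia.
  by rewrite mem_filter => /andP[/eqP->]; lia.
have -> : levels_rec le m.+1 w' =
    take (size u) w' :: levels_rec le m (drop (size u) w') by rewrite -apu.
rewrite {1 2}Ew take_size_cat // drop_size_cat // Ed /=; congr cons.
apply/eq_in_map => j; rewrite mem_iota => /andP[kj _].
rewrite -filter_predI; apply: eq_filter => z /=.
by case: eqP => // ->.
Qed.

(** Conversely, the greedy cutting of a word in which no entry lies below an earlier one provides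
    the level function. *)
Lemma graded_exists k w : uniq w ->
  pairwise (fun x y => ~~ slt le y x) w -> exists f, graded f k w.
Proof.
have [m] := ubnP (size w); elim: m k w => // m IH k [|a w] sz uw lw.
  by exists (fun=> k); split=> // j x u kj.
set w' := a :: w in sz uw lw *.
set r := antichain_prefix le w'.
have r0 : 0 < r by exact: antichain_prefix_gt0.
set u := take r w'; set v := drop r w'.
have Ew : w' = u ++ v by rewrite cat_take_drop.
have uv : uniq (u ++ v) by rewrite -Ew.
have lv : pairwise (fun x y => ~~ slt le y x) (u ++ v) by rewrite -Ew.
have [|||f [sv kv hv mv ev]] := IH k.+1 v.
- by rewrite size_drop; move: sz r0; rewrite -/w'; case: (r) => //= r'; lia.
- by move: uv; rewrite cat_uniq => /and3P[].
- by move: lv; rewrite pairwise_cat => /and3P[].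
have au : antichain le [in u].
  rewrite /u /r /antichain_prefix.
  (* The empty prefix is an antichain, so the maximum defining [antichain_prefix] is attained. *)
  have P0 : antichain le [in take (@ord0 (size w')) w'].
    by apply/forall_inP => x; rewrite take0.
  by rewrite (bigmax_eq_arg _ P0); case: arg_maxnP.
have hx : if v is x :: _ then exists2 y, y \in u & slt le y x else True.
  case def_v: v => [//|x v'].
  (* Otherwise the prefix of length [r.+1] would contradict the maximality of [r]. *)
  have /negP : ~~ antichain le [in rcons u x].
    apply/negP => ax; have rs : r.+1 < (size w').+1.
      have : size u < size w' by rewrite Ew def_v size_cat /= addnS ltnS
        leq_addr.
      by rewrite size_take_min gtn_min ltnn orbF.
    have : r.+1 <= r; last by rewrite ltnn.
    apply: (@leq_trans (Ordinal rs)) => //.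
    apply: (leq_bigmax_cond (F := @nat_of_ord _)).
    suff -> : take r.+1 w' = rcons u x by [].
    have us : size u = r by rewrite size_takel // -ltnS ltnW.
    by rewrite Ew def_v /= take_cat us ltnNge leqnSn /= subSnn /= take0 cats1.
  rewrite /antichain => H.
  have [[y yu xy]|no] := @hasP _ (fun y => slt le y x) u; first by exists y.
  (* A comparable pair in [rcons u x] must involve [x], and [x] lies below no entry of [u]; so some
     entry of [u] lies below [x]. *)
  case: H; apply/forall_inP => b; rewrite /= mem_rcons inE => bu.
  apply/forall_inP => c; rewrite /= mem_rcons inE => cu.
  apply/implyP => bc; apply/negP => lbc.
  have xb z : z \in u -> ~~ slt le x z.
    move=> zu; move: lv; rewrite pairwise_cat => /and3P[/allrelP al _ _].
    by apply: al => //; rewrite def_v inE eqxx.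
  case/orP: bu => [/eqP Eb|bu]; case/orP: cu => [/eqP Ec|cu].
  - by rewrite Eb Ec eqxx in bc.
  - by have := xb c cu; rewrite /slt -Eb bc lbc.
  - by case: no; exists b; rewrite ?bu // /slt -Ec bc lbc.
  move/forall_inP: au => /(_ b bu)/forall_inP/(_ c cu).
  by rewrite bc lbc.
pose g x := if x \in u then k else f x.
have gu x : x \in u -> g x = k by rewrite /g => ->.
have vNu x : x \in v -> x \notin u.
  by move: uv; rewrite cat_uniq => /and3P[_ /hasPn h _] /h.
have gv x : x \in v -> g x = f x by move/vNu; rewrite /g => /negPf->.
exists g; split.
- rewrite Ew pairwise_cat; apply/and3P; split.
  + apply/allrelP => x y xu yv; rewrite /= gu // gv //.
    by have := allP kv y yv; lia.
  + by apply/(pairwiseP a) => i j iu ju _; rewrite /= !gu ?mem_nth.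
  + apply/(pairwiseP a) => i j iv jv ij; rewrite /= !gv ?mem_nth //.
    by move/(pairwiseP a): sv; apply.
- apply/allP => x; rewrite Ew mem_cat => /orP[/gu->//|xv].
  by rewrite gv //; have := allP kv x xv; lia.
- by rewrite /w' gu // /u; case: (r) r0 => //= r'; rewrite inE eqxx.
- move=> x y; rewrite Ew !mem_cat => /orP[xu|xv] /orP[yu|yv] xy.
  + move/forall_inP: au => /(_ x xu)/forall_inP/(_ y yu).
    by case/andP: xy => -> ->.
  + by rewrite gu // gv //; have := allP kv y yv; lia.
  + move: lv; rewrite pairwise_cat => /and3P[/allrelP al _ _].
    by have := al y x yu xv; rewrite xy.
  + by rewrite !gv //; apply: mv.
have fu j : k <= j -> [seq z <- w' | g z == j.+1] = [seq z <- v | f z == j.+1].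
  move=> kj; rewrite Ew filter_cat [X in X ++ _](_ : _ = [::]) /=.
    by apply: eq_in_filter => z zv; rewrite gv.
  apply/eqP; rewrite -[_ == _]negbK -has_filter -all_predC; apply/allP => z zu.
  by rewrite /= gu //; lia.
move=> j x s kj; rewrite fu //; rewrite leq_eqVlt in kj.
(* For [j = k] the witness comes from [hx], the maximality of the prefix [u]; larger [j] only
   concern [v]. *)
case/orP: kj => [/eqP <- Es|kj /ev[//|y yv /andP[fy yx]]]; last first.
  by exists y; rewrite ?gv ?fy // Ew mem_cat yv orbT.
case: (v) hv hx Es => [//|z v'] hz [y yu yz] /=; rewrite hz => -[<- _].
by exists y; rewrite ?gu ?eqxx ?yz // Ew mem_cat yu.
Qed.
End Words.

Lemma uniq_mem_flatten (T : eqType) (ss : seq (seq T)) (s : seq T) :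
  uniq (flatten ss) -> s \in ss -> uniq s.
Proof.
move=> uss /path.splitPr def_ss; case: def_ss uss => s1 s2.
by rewrite flatten_cat cat_uniq /= cat_uniq => /and3P[_ _ /and3P[]].
Qed.

Lemma sum_count_eq (T : Type) (f : T ->
  nat) (a : pred T) (d : nat) (s : seq T) :
  all (fun x => f x < d) s ->
  \sum_(k < d) count (fun x => (f x == k) && a x) s = count a s.
Proof.
elim: s => [|x s IH] /=; first by rewrite big1.
case/andP=> fx /IH <-; rewrite big_split /=; congr (_ + _).
rewrite (bigD1 (Ordinal fx)) //= eqxx big1 ?addn0 // => k.
by rewrite -val_eqE /= eq_sym => /negPf->.
Qed.

Lemma pairwise_flatten (T : eqType) (r : rel T) (ss : seq (seq T)) :
  all (pairwise r) ss -> pairwise (allrel r) ss -> pairwise r (flatten ss).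
Proof.
elim: ss => //= s ss IH /andP[rs rss] /andP[/allP rA pss].
rewrite pairwise_cat rs IH // !andbT.
elim: ss {IH rss pss} rA => [|b ss IH] rA; first by rewrite /= allrel0r.
rewrite /= allrel_catr; apply/andP; split; first by apply: rA; rewrite mem_head.
by apply: IH => c cs; apply: rA; rewrite inE cs orbT.
Qed.

(** * Linear extensions as words, and their left-to-right maxima *)

Section Order.
Variables (n : nat) (le : rel 'I_n).
Implicit Types (f : 'I_n -> nat) (s t : 'S_n).

Lemma mem_word s x : x \in word s.
Proof. by apply/mapP; exists ((s^-1)%g x); rewrite ?mem_enum ?permKV. Qed.

Lemma word_uniq s : uniq (word s).
Proof. by rewrite map_inj_uniq ?enum_uniq //; apply: perm_inj. Qed.

Lemma word_inj : injective (@word n).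
Proof.
move=> s t /eq_in_map st; apply/permP => i.
by apply: st; rewrite mem_enum.
Qed.

Lemma word_exists (w : seq 'I_n) : perm_eq w (enum 'I_n) ->
  exists s, word s = w.
Proof.
move=> pw; have sw : size w == n by rewrite (perm_size pw) size_enum_ord.
have /tuple_uniqP ut : uniq (Tuple sw) by rewrite (perm_uniq pw) enum_uniq.
exists (perm ut); rewrite /word -[RHS](map_tnth_enum (Tuple sw)).
by apply: eq_map => i; rewrite permE.
Qed.

Lemma pairwise_enum_ord : pairwise (fun i j : 'I_n => i < j) (enum 'I_n).
Proof.
rewrite -(pairwise_map val ltn) val_enum_ord -(sorted_pairwise ltn_trans).
exact: iota_ltn_sorted.
Qed.

Lemma linear_extension_pairwise s : s \in linear_extensions le ->
  pairwise (fun x y => ~~ slt le y x) (word s).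
Proof.
rewrite inE => /forallP ls; rewrite pairwise_map.
apply: sub_pairwise pairwise_enum_ord => i j ij /=; apply/negP => sji.
have := forallP (ls (s j)) (s i).
by rewrite sji !permK ltnNge ltnW.
Qed.

Lemma linear_extension_monotone s f :
  {homo f : x y / slt le x y >-> x < y} -> pairwise (relpre f leq) (word s) ->
  s \in linear_extensions le.
Proof.
move=> fm; rewrite pairwise_map inE => ps.
apply/forallP => x; apply/forallP => y; apply/implyP => /fm fxy.
rewrite ltnNge; apply/negP;
  rewrite leq_eqVlt => /orP[/eqP/val_inj/perm_inj Exy|yx].
  by move: fxy; rewrite Exy ltnn.
have := (pairwiseP x ps) _ _ _ _ yx;
  rewrite !inE size_enum_ord !nth_ord_enum /=.
by rewrite !permKV [f y <= f x]leqNgt fxy => /(_ (ltn_ord _) (ltn_ord _)).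
Qed.

(** Depends on the level function only, so that it applies to the cycles of a permutation before any
    word is written. *)
Definition ess f (x : 'I_n) : bool :=
  (f x == 0) || [exists y, slt le y x && ((f y).+1 == f x)].

Definition lrmax_at f (w : seq 'I_n) (x : 'I_n) : bool :=
  ess f x &&
  all (fun y : 'I_n => (f y == f x) && ess f y ==>
    (y < x)) (take (index x w) w).

(** The levels are the fibres of [f], and filtering commutes with taking the part before [x]; so the
    maxima of the separate levels can be counted in the whole word. *)
Lemma LRmax_graded s f : graded le f 0 (word s) ->
  LRmax le s = count (lrmax_at f (word s)) (word s).
Proof.
move=> gf; have [d [fd Els]] := levels_rec_graded gf (leqnn _).
rewrite /LRmax /levels; set w := word s in gf fd Els *.
rewrite Els size_map size_iota -(sum_count_eq _ fd).
apply: eq_bigr => -[k kd] _ /=; pose p x := (f x == k) && ess f x.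
have nthE j : j < d -> nth [::] [seq [seq x <- w | f x == j] | j <- iota 0 d] j
    = [seq x <- w | f x == j].
  by move=> jd; rewrite (nth_map 0) ?size_iota // nth_iota.
have -> : essential le [seq [seq x <- w | f x == j] | j <- iota 0 d] k
    = [seq x <- w | p x].
  rewrite /essential; case: k kd @p => [|k] kd p.
    rewrite nthE //; apply: eq_filter => x.
    by rewrite /p /ess; case: (f x == 0).
  rewrite !nthE ?(ltnW kd) // -filter_predI; apply: eq_filter => x /=.
  rewrite /p /ess; case: (eqVneq (f x) k.+1) => [->|];
    rewrite ?andbF ?andbT //=.
  apply/hasP/existsP => [[y]|[y /andP[yx fy]]].
    by rewrite mem_filter => /andP[/eqP<- _] yx; exists y; rewrite yx eqxx.
  by exists y => //; rewrite mem_filter mem_word andbT -eqSS.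
rewrite /lrmaxima -size_filter; congr size.
rewrite [LHS](@eq_in_filter _ _ (lrmax_at f w)); last first.
  move=> x; rewrite mem_filter => /andP[px _].
  rewrite take_index_filter // all_filter /lrmax_at.
  by case/andP: (px) => /eqP fx ->; apply: eq_all => y; rewrite /= /p fx.
rewrite -filter_predI; apply: eq_filter => x /=.
by rewrite /p /lrmax_at; case: (ess f x); rewrite !(andbF, andbT) // andbC.
Qed.

End Order.

(** * Cycle forms *)

Section Segments.
Variable T : eqType.
Implicit Types (c : T * seq T) (ss : seq (T * seq T)) (H : pred T).

Definition cseq c : seq T := c.1 :: c.2.
Definition cword ss : seq T := flatten (map cseq ss).

(** The first segment ends just before the second marked entry, so the cuts can be read off the
    word. *)
Lemma cword_segments H ss : all (fun c => H c.1 && ~~ has H c.2) ss ->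
  forall ss', all (fun c => H c.1 && ~~ has H c.2) ss' ->
  cword ss = cword ss' -> ss = ss'.
Proof.
(* This includes empty [s0], where [find] returns the size 0 of the empty word. *)
have find_cword s0 : all (fun c => H c.1 && ~~ has H c.2) s0 ->
    find H (cword s0) = 0.
  by case: s0 => //= c s0 /andP[/andP[-> _] _].
elim: ss => [_|[h u] ss IH /= /andP[/andP[Hh Hu] Hss]] [|[h' u'] ss'] //=.
move=> /andP[/andP[Hh' Hu'] Hss'] [<- E].
have Eu : size u = size u'.
  have := congr1 (find H) E; rewrite !find_cat (negPf Hu) (negPf Hu').
  by rewrite !find_cword // !addn0.
have /eqP := E; rewrite eqseq_cat // => /andP[/eqP<- /eqP/IH->] //.
Qed.

Lemma segments_exist H (w : seq T) : (if w is x :: _ then H x else true) ->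
  exists2 ss, cword ss = w & all (fun c => H c.1 && ~~ has H c.2) ss.
Proof.
have [m] := ubnP (size w); elim: m w => // m IH [|x w] sz Hx;
  first by exists [::].
have [||ss Ess Hss] := IH (drop (find H w) w).
- by rewrite size_drop; move: sz => /=; lia.
- case Ed: (drop _ w) => [//|y v]; have fw : find H w < size w.
    by rewrite ltnNge; apply/negP => /drop_oversize; rewrite Ed.
  have := nth_find x (etrans (has_find _ _) fw).
  by rewrite -[find H w]addn0 -nth_drop Ed.
exists ((x, take (find H w) w) :: ss) => /=.
  by rewrite /cword /= -/(cword ss) Ess cat_take_drop.
rewrite Hx Hss /= andbT; apply/negP => /(has_nthP x)[i].
rewrite size_take_min leq_min => /andP[fi _].
by rewrite nth_take // before_find.
Qed.

Lemma mem_cword ss x : reflect (exists2 c, c \in ss & x \in cseq c) (x \in cword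
  ss).
Proof.
apply: (iffP flatten_mapP) => [[c cs xc]|[c cs xc]]; by exists c.
Qed.

Lemma cword_split c ss : c \in ss ->
  exists p q, ss = p ++ c :: q /\ cword ss = cword p ++ cseq c ++ cword q.
Proof.
case/path.splitPr=> p q; exists p, q.
by rewrite /cword map_cat flatten_cat.
Qed.

Lemma cword_inj ss c d x : uniq (cword ss) ->
  c \in ss -> d \in ss -> x \in cseq c -> x \in cseq d -> c = d.
Proof.
move=> uss /cword_split[s1 [s2 [Ess Ew]]]; move: uss; rewrite {}Ew {ss}Ess.
rewrite !cat_uniq => /and3P[_ /hasPn N1 /and3P[_ /hasPn N2 _]].
rewrite mem_cat inE => /or3P[ds xc xd|/eqP->//|ds xc xd].
  have := N1 x; rewrite mem_cat xc => /(_ isT)/negP[].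
  by apply/mem_cword; exists d.
have xw : x \in cword s2 by apply/mem_cword; exists d.
by have := N2 x xw; rewrite /= xc.
Qed.

Lemma filter_cword (p : pred T) ss :
  (forall c x, c \in ss -> x \in c.2 -> p x = p c.1) ->
  filter p (cword ss) = cword [seq c <- ss | p c.1].
Proof.
elim: ss => //= c ss IH pc; rewrite /cword /= filter_cat -/(cword ss) IH;
  last first.
  by move=> d x ds; apply: pc; rewrite inE ds orbT.
rewrite (@eq_in_filter _ p (fun=> p c.1)); last by move=> x; apply: pc;
  rewrite mem_head.
by case: (p c.1); rewrite ?filter_predT ?filter_pred0.
Qed.

End Segments.

Lemma porbit_cycle (T : finType) (t : {perm T}) (p : seq T) (x y : T) :
  fcycle t p -> x \in p -> (y \in porbit t x) = (y \in p).
Proof.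
move=> tp xp; rewrite -(fconnect_cycle tp xp).
apply/porbitP/idP => [[i ->]|/iter_findex <-];
  first by rewrite permX fconnect_iter.
by exists (findex t x y); rewrite permX.
Qed.

Lemma porbit_const (T : finType) (U : Type) (h : T -> U) (t : {perm T}) x y :
  (forall z, h (t z) = h z) -> y \in porbit t x -> h y = h x.
Proof.
move=> ht /porbitP[i ->]; elim: i => [|i IH]; first by rewrite perm1.
by rewrite permX iterS ht -permX.
Qed.

(** * Permutations written in cycle form *)

Section CycleForm.
Variables (n : nat) (le : rel 'I_n).
Implicit Types (f : 'I_n -> nat) (t : 'S_n) (ss : seq ('I_n * seq 'I_n)).

(* Orders pairs [(f x, x)] lexicographically. *)
Definition key f (x : 'I_n) : nat := f x * n + x.

Lemma key_ltn f x y : (key f x < key f y) = (f x < f y) || ((f x == f y) && (x <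
  y)).
Proof.
rewrite /key; have := ltn_ord x; have := ltn_ord y;
  case: (ltngtP (f x) (f y)) => /= [|fyx|->].
- by move=> fxy xn yn; nia.
- by move=> xn yn; apply/negP; nia.
by rewrite ltn_add2l.
Qed.

Lemma key_inj f : injective (key f).
Proof.
move=> x y Exy; have := key_ltn f x y; have := key_ltn f y x.
rewrite Exy ltnn; case: (ltngtP (f x) (f y)) => //= _.
by case: ltngtP => // /val_inj.
Qed.

(* The cycles of [t], written with their largest essential entry first and
   sorted by level, then by first entry; the levels [f] are those of the
   poset of cycles. *)
Record cycle_form t f ss : Prop := CycleForm {
  cf_perm : perm_eq (cword ss) (enum 'I_n);
  cf_mono : {homo f : x y / slt le x y >-> x < y};
  cf_cycle : forall c, c \in ss -> fcycle t (cseq c);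
  cf_const : forall c x, c \in ss -> x \in c.2 -> f x = f c.1;
  cf_ess : forall c, c \in ss -> ess le f c.1;
  cf_max : forall c x, c \in ss -> x \in c.2 -> ess le f x -> x < c.1;
  cf_sorted : pairwise ltn (map (key f) (map fst ss))
}.

Section Properties.
Variables (t : 'S_n) (f : 'I_n -> nat) (ss : seq ('I_n * seq 'I_n)).
Hypothesis cf : cycle_form t f ss.

Lemma cf_uniq : uniq (cword ss).
Proof. by rewrite (perm_uniq (cf_perm cf)) enum_uniq. Qed.

Lemma cf_mem x : exists2 c, c \in ss & x \in cseq c.
Proof. by apply/mem_cword; rewrite (perm_mem (cf_perm cf)) mem_enum. Qed.

Lemma cf_porbit c x y : c \in ss -> x \in cseq c ->
  (y \in porbit t x) = (y \in cseq c).
Proof. by move=> cs; apply: porbit_cycle; apply: (cf_cycle cf). Qed.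

Lemma cf_constP c x : c \in ss -> x \in cseq c -> f x = f c.1.
Proof. by move=> cs; rewrite inE => /predU1P[->//|]; apply: (cf_const cf). Qed.

Lemma cf_const_porbit x y : y \in porbit t x -> f y = f x.
Proof.
have [c cs xc] := cf_mem x; rewrite (cf_porbit _ cs xc) => yc.
by rewrite !(cf_constP cs).
Qed.

Lemma cf_maxP c x : c \in ss -> x \in cseq c -> ess le f x -> x <= c.1.
Proof.
by move=> cs; rewrite inE => /predU1P[->//|xc ex]; apply/ltnW/(cf_max cf).
Qed.

Lemma cf_orbit c : c \in ss -> cseq c = fingraph.orbit t c.1.
Proof.
move=> cs; rewrite -(undup_cycle_cons (cf_cycle cf cs)) undup_id //.
by apply: uniq_mem_flatten cf_uniq _; apply: map_f.
Qed.

Lemma cf_inj c d x :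
  c \in ss -> d \in ss -> x \in cseq c -> x \in cseq d -> c = d.
Proof. exact: cword_inj cf_uniq. Qed.

(** Describes the heads by [t] and [f] alone, which makes them independent of the cycle form. *)
Lemma cf_headE x : (x \in map fst ss) =
  ess le f x && [forall (y | y \in porbit t x), ess le f y ==> (y <= x)].
Proof.
apply/mapP/andP => [[c cs ->]|[ex /forall_inP mx]].
  split; first exact: (cf_ess cf).
  apply/forall_inP => y; rewrite (@cf_porbit c) ?mem_head // => yc.
  by apply/implyP; apply: cf_maxP.
have [c cs xc] := cf_mem x; exists c => //; apply/val_inj/eqP.
have ct : c.1 \in porbit t x by rewrite (@cf_porbit c) ?mem_head.
by rewrite eqn_leq cf_maxP // (implyP (mx _ ct)) // (cf_ess cf).
Qed.

Lemma cf_f_sorted : pairwise (relpre f leq) (cword ss).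
Proof.
apply: pairwise_flatten.
  apply/allP => _ /mapP[c cs ->].
  apply/(pairwiseP c.1) => i j ic jc _; rewrite /=.
  by rewrite !(cf_constP cs) // mem_nth.
rewrite pairwise_map; have := cf_sorted cf; rewrite -map_comp pairwise_map.
apply: (sub_in_pairwise (P := [in ss])); last exact: allss.
move=> c d cs ds /=; rewrite key_ltn => cd; apply/allrelP => x y xc yd.
by rewrite /= (cf_constP cs xc) (cf_constP ds yd);
  case/orP: cd => [/ltnW//|/andP[/eqP->]].
Qed.

(** The first entry of each level is the head of a cycle, hence essential; this gives the last
    clause of [graded]. *)
Lemma cf_graded : graded le f 0 (cword ss).
Proof.
have memw x : x \in cword ss by rewrite (perm_mem (cf_perm cf)) mem_enum.
split; first exact: cf_f_sorted.
- by apply/allP.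
(* If the first head had positive level, being essential it would need an entry of lower level,
   against sortedness. *)
- case Ess: ss => [//|c s0] /=; have cs : c \in ss by rewrite Ess mem_head.
  have /orP[//|/existsP[y /andP[_ /eqP fy]]] := cf_ess cf cs.
  have := cf_f_sorted; have := memw y; rewrite Ess /= inE => /predU1P[yc|yw].
    by move/eqP: fy; rewrite yc eqn_leq ltnn.
  by case/andP=> /allP/(_ y yw) /=; rewrite -fy ltnn.
- by move=> x y _ _; apply: (cf_mono cf).
move=> j x u _.
have -> : [seq z <- cword ss | f z == j.+1] =
          cword [seq c <- ss | f c.1 == j.+1].
  by apply: filter_cword => c z cs zc; rewrite (cf_const cf cs zc).
case Ec: [seq c <- ss | _] => [//|c s0] [<- _].
have : c \in [seq c <- ss | f c.1 == j.+1] by rewrite Ec mem_head.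
rewrite mem_filter => /andP[/eqP fc /(cf_ess cf)]; rewrite /ess fc.
by case/existsP=> y /andP[yc]; rewrite eqSS => fy; exists y; rewrite ?memw ?fy.
Qed.

(** An essential entry of the same level before a head lies in an earlier cycle, whose head bounds
    it and is smaller. An essential entry that is not a head comes after the head of its own cycle,
    which is at least as large. *)
Lemma cf_lrmax x : lrmax_at le f (cword ss) x = (x \in map fst ss).
Proof.
have [c cs xc] := cf_mem x.
have [s1 [s2 [Ess Ew]]] := cword_split cs; have uw := cf_uniq.
have lt1 d : d \in s1 -> key f d.1 < key f c.1.
  move=> ds; have := cf_sorted cf; rewrite Ess !map_cat pairwise_cat.
  by case/and3P=> /allrelP h _ _; apply: h; rewrite ?mem_head // map_f // map_f.
have -> : (x \in map fst ss) = (x == c.1).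
  apply/mapP/eqP => [[d ds Ex]|->]; last by exists c.
  by rewrite (@cf_inj c d x) // Ex mem_head.
rewrite /lrmax_at; case: eqVneq => [Ex|xNc].
  rewrite Ex (cf_ess cf) // Ew take_index_cat; last first.
    by move: uw; rewrite Ew cat_uniq => /and3P[_ /hasPn/(_ c.1)];
      rewrite mem_head => /(_ isT).
  apply/allP => y /mem_cword[d ds yd]; apply/implyP => /andP[/eqP fy ey].
  have dss : d \in ss by rewrite Ess mem_cat ds.
  apply: (leq_ltn_trans (cf_maxP dss yd ey)).
  by have := lt1 d ds; rewrite key_ltn -(cf_constP dss yd) fy ltnn eqxx.
have xNs1 y : y \in cseq c -> y \notin cword s1.
  move=> yc; move: uw; rewrite Ew cat_uniq => /and3P[_ /hasPn h _].
  by apply: h; rewrite mem_cat yc.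
have c_first : c.1 \in take (index x (cword ss)) (cword ss).
  have cw : c.1 \in cword ss by apply/mem_cword; exists c; rewrite ?mem_head.
  rewrite in_take // Ew !index_cat !(negPf (xNs1 _ _)) ?mem_head //= eqxx.
  by rewrite eq_sym (negPf xNc) xc ltn_add2l.
apply/negP => /andP[ex /allP /(_ _ c_first)].
rewrite (cf_ess cf) // (cf_constP cs xc) eqxx /= ltnNge.
by rewrite cf_maxP.
Qed.
End Properties.
End CycleForm.

(** * Transverse permutations and rank functions on their cycles *)

Section Transverse.
Variables (n : nat) (le : rel 'I_n).

(** Along the quotient preorder [h] grows strictly unless the block stays the same, which excludes
    comparable entries in a block and two-way related blocks. The target is a general order: levels
    use [nat], points of the cone use real coordinates. *)
Lemma transverse_monotone d (T : orderType d) (h : 'I_n -> T) (t : 'S_n) :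
  (forall x, h (t x) = h x) -> {homo h : x y / slt le x y >-> (x < y)%O} ->
  t \in transverse_perms le.
Proof.
move=> ht hm.
have hc x y : y \in porbit t x -> h y = h x by exact: porbit_const.
have hB B x y : B \in porbits t -> x \in B -> y \in B -> h x = h y.
  by case/imsetP=> z _ -> /hc -> /hc ->.
have step B C : block_rel le (porbits t) B C -> B = C \/
    forall x y, x \in B -> y \in C -> (h x < h y)%O.
  case/and3P=> Bp Cp /existsP[x /andP[xB /existsP[y /andP[yC xy]]]].
  have [Exy|Nxy] := eqVneq x y.
    left; case/imsetP: Bp xB => u _ ->; case/imsetP: Cp yC => v _ ->.
    by rewrite Exy -!eq_porbit_mem => /eqP<- /eqP<-.
  right=> u v uB vC; rewrite (hB B u x) // (hB C v y) //.
  by apply: hm; rewrite /slt Nxy.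
have path_lt B C : B \in porbits t -> quotient_le le (porbits t) B C -> B = C \/
    forall x y, x \in B -> y \in C -> (h x < h y)%O.
  move=> Bp /connectP[p]; elim/last_ind: p C => [|p D IH] C /=.
    by move=> _ ->; left.
  rewrite rcons_path last_rcons => /andP[/IH/(_ erefl)hB' hs] ->.
  set E := last B p in hB' hs.
  have [<-//|lt2] := step _ _ hs; case: hB' => [->|lt1]; first by right.
  right=> x y xB yD; case/and3P: hs => /imsetP[z _ EE] _ _.
  have zE : z \in E by rewrite EE porbit_id.
  exact: Order.POrderTheory.lt_trans (lt1 _ _ xB zE) (lt2 _ _ zE yD).
rewrite inE; apply/andP; split.
  apply/forall_inP => B Bp; apply/forall_inP => x xB; apply/forall_inP => y yB.
  apply/implyP => Nxy; apply/negP => xy.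
  have := hm x y; rewrite /slt Nxy xy (hB B x y) // => /(_ isT).
  by rewrite Order.POrderTheory.ltxx.
apply/forall_inP => B Bp; apply/forall_inP => C Cp;
  apply/implyP => /andP[BC CB].
have [->//|lt1] := path_lt _ _ Bp BC; have [->//|lt2] := path_lt _ _ Cp CB.
case/imsetP: Bp lt1 lt2 => x _ ->; case/imsetP: Cp => y _ -> lt1 lt2.
have := lt1 x y; rewrite !porbit_id => /(_ isT isT) xy.
have := lt2 y x; rewrite !porbit_id =>
  /(_ isT isT) /(Order.POrderTheory.lt_trans xy).
by rewrite Order.POrderTheory.ltxx.
Qed.

(** The rank of [x] is the number of cycles below or equal to its cycle. If [x] is below [y], the
    cycle of [y] is counted only for [y]; otherwise both would lie in one cycle, which is an
    antichain. *)
Lemma transverse_rank (t : 'S_n) : t \in transverse_perms le ->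
  exists h : 'I_n -> nat,
    (forall x, h (t x) = h x) /\ {homo h : x y / slt le x y >-> x < y}.
Proof.
rewrite inE => /andP[/forall_inP anti /forall_inP pos].
pose Q := quotient_le le (porbits t).
pose h x := #|[set C in porbits t | Q C (porbit t x)]|.
have porbit_porbits x : porbit t x \in porbits t by apply: imset_f.
exists h; split=> [x|x y /andP[Nxy xy]].
  by rewrite /h (porbit_perm t 1 x).
have Qxy : Q (porbit t x) (porbit t y).
  apply: connect1; rewrite /block_rel !porbit_porbits.
  by apply/existsP; exists x; rewrite porbit_id; apply/existsP; exists y;
    rewrite porbit_id.
apply/proper_card/properP; split.
  apply/fintype.subsetP => C; rewrite !inE => /andP[-> /= CP].
  exact: connect_trans CP Qxy.
exists (porbit t y); rewrite inE porbit_porbits /=; first exact: connect0.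
apply/negP => Qyx.
have /implyP := forall_inP (pos _ (porbit_porbits x)) _ (porbit_porbits y).
move/(_ (introT andP (conj Qxy Qyx))); rewrite eq_porbit_mem => xty.
have := forall_inP (forall_inP (anti _ (porbit_porbits y)) x xty) y (porbit_id _
  _).
by rewrite Nxy xy.
Qed.

End Transverse.

(** * Statistics and uniqueness of cycle forms *)

Section Properties.
Variables (n : nat) (le : rel 'I_n).
Implicit Types (f : 'I_n -> nat) (s t : 'S_n) (ss : seq ('I_n * seq 'I_n)).

Lemma cf_heads_uniq t f ss : cycle_form le t f ss -> uniq (map fst ss).
Proof. by move=> cf; apply: map_uniq (pairwise_uniq ltnn (cf_sorted cf)). Qed.

Lemma cf_LRmax t f ss s : cycle_form le t f ss -> word s = cword ss ->
  LRmax le s = size ss.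
Proof.
move=> cf Es; have gf := cf_graded cf; rewrite -Es in gf.
rewrite (LRmax_graded gf) Es -size_filter -(size_map fst ss).
apply/perm_size/uniq_perm; first by rewrite filter_uniq // -Es word_uniq.
  exact: cf_heads_uniq cf.
by move=> x; rewrite mem_filter (cf_lrmax cf) -Es mem_word andbT.
Qed.

Lemma cf_cyc t f ss : cycle_form le t f ss -> cyc t = size ss.
Proof.
move=> cf; rewrite /cyc -(size_map fst ss) -(card_uniqP (cf_heads_uniq cf)).
rewrite -[RHS]cardsE -(@card_in_imset _ _ (porbit t)).
  apply/eq_card => B; apply/imsetP/imsetP => [[x _ ->]|[x _ ->]];
    last by exists x.
  have [c cs xc] := cf_mem cf x; exists c.1; first by rewrite inE map_f.
  by apply/eqP; rewrite eq_porbit_mem (cf_porbit cf _ cs) ?mem_head.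
move=> _ _ /[!inE] /mapP[c cs ->] /mapP[d ds ->] /eqP.
rewrite eq_porbit_mem (cf_porbit cf _ ds) ?mem_head // => cd.
by rewrite (cf_inj cf cs ds _ cd) ?mem_head.
Qed.

Lemma cf_transverse t f ss : cycle_form le t f ss -> t \in transverse_perms le.
Proof.
move=> cf; apply: (@transverse_monotone _ le _ _ f) (cf_mono cf) => x.
by apply: (cf_const_porbit cf); rewrite (mem_porbit t 1 x).
Qed.

Lemma cf_linear_extension t f ss s : cycle_form le t f ss ->
  word s = cword ss ->
  s \in linear_extensions le.
Proof.
move=> cf Es; apply: linear_extension_monotone (cf_mono cf) _.
by rewrite Es; apply: (cf_f_sorted cf).
Qed.

(** Induction on the level: the head of the cycle of [x] is essential, so it covers an entry exactly
    one [f]-level lower, while [f'] drops by at least one. Used in both directions, this makes the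
    levels unique. *)
Lemma cf_level_le t f f' ss ss' :
  cycle_form le t f ss -> cycle_form le t f' ss' -> forall x, f x <= f' x.
Proof.
move=> cf cf' x; have [m] := ubnP (f x); elim: m x => // m IH x fx.
have [c cs xc] := cf_mem cf x.
have -> : f' x = f' c.1.
  by apply: (cf_const_porbit cf'); rewrite (cf_porbit cf _ cs) ?mem_head.
have Ex := cf_constP cf cs xc; have := cf_ess cf cs.
rewrite /ess -Ex => /orP[/eqP->//|/existsP[y /andP[yc /eqP fy]]].
rewrite -fy in fx *; apply: leq_ltn_trans (cf_mono cf' yc).
exact: IH.
Qed.

(** The same induction along a word: the first entry [z] of the level of [x] lies above an entry one
    level lower, and [f'] does not decrease from [z] to [x]. *)
Lemma graded_level_le f f' w : graded le f 0 w -> graded le f' 0 w ->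
  {in w, forall x, f x <= f' x}.
Proof.
case=> sw _ _ mw ew [sw' _ _ mw' _] x.
have [m] := ubnP (f x); elim: m x => // m IH x fx xw.
case Efx: (f x) => [//|j]; have : x \in [seq z <- w | f z == j.+1].
  by rewrite mem_filter Efx eqxx.
have sf := pairwise_filter (fun z => f z == j.+1) sw'.
case Ez: [seq z <- w | _] sf => [//|z u] /= /andP[/allP zu _] xz.
have [//|y yw /andP[/eqP fy yz]] := ew _ _ _ _ Ez.
have zw : z \in w.
  have : z \in [seq z <- w | f z == j.+1] by rewrite Ez mem_head.
  by rewrite mem_filter => /andP[].
have fzx : f' z <= f' x by move: xz; rewrite inE => /predU1P[->//|/zu].
apply: leq_trans fzx; apply: leq_ltn_trans (mw' y z yw zw yz).
by rewrite -fy IH // fy -ltnS -Efx.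
Qed.

(** The permutation determines the levels, these the heads and their order by [key], and each head
    its orbit. *)
Lemma cf_cword_unique t f f' ss ss' :
  cycle_form le t f ss -> cycle_form le t f' ss' -> ss = ss'.
Proof.
move=> cf cf'; have Ef : f = f'.
  apply/funext => x; apply/eqP.
  by rewrite eqn_leq (cf_level_le cf cf') (cf_level_le cf' cf).
rewrite {}Ef {f} in cf.
have Eh : map fst ss = map fst ss'.
  apply: (inj_map (@key_inj _ f')); apply: (irr_sorted_eq ltn_trans ltnn).
  - by rewrite (sorted_pairwise ltn_trans) (cf_sorted cf).
  - by rewrite (sorted_pairwise ltn_trans) (cf_sorted cf').
  by apply: eq_mem_map => x; rewrite (cf_headE cf) (cf_headE cf').
have ssE f0 (s0 : seq _) : cycle_form le t f0 s0 ->
    s0 = [seq (h, behead (fingraph.orbit t h)) | h <- map fst s0].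
  move=> cf0; rewrite -map_comp -[LHS]map_id; apply/eq_in_map => c cs /=.
  by rewrite -(cf_orbit cf0 cs); case: (c).
by rewrite (ssE _ _ cf) (ssE _ _ cf') Eh.
Qed.

(** The word determines the levels, these the left-to-right maxima, and cutting before the maxima
    gives the cycles. *)
Lemma cf_perm_unique t t' f f' ss ss' : cword ss = cword ss' ->
  cycle_form le t f ss -> cycle_form le t' f' ss' -> t = t'.
Proof.
move=> Ew cf cf'.
have memw x : x \in cword ss by rewrite (perm_mem (cf_perm cf)) mem_enum.
have Ef : f = f'.
  have g := cf_graded cf; have g' := cf_graded cf'; rewrite -Ew in g'.
  apply/funext => x; apply/eqP.
  by rewrite eqn_leq (graded_level_le g g') // (graded_level_le g' g).
rewrite {}Ef {f} in cf.
have seg t0 (s0 : seq _) : cycle_form le t0 f' s0 ->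
    all (fun c => lrmax_at le f' (cword s0) c.1 &&
                  ~~ has (lrmax_at le f' (cword s0)) c.2) s0.
  move=> cf0; apply/allP => c cs; rewrite (cf_lrmax cf0) map_f //=.
  apply/hasPn => x xc; rewrite (cf_lrmax cf0); apply/mapP => -[d ds Ex].
  have Ecd : c = d by apply: (cf_inj cf0 (x := x)) => //;
    rewrite inE ?xc ?orbT // Ex eqxx.
  have : uniq (cseq c) by apply: uniq_mem_flatten (cf_uniq cf0) _; apply: map_f.
  by rewrite /= -[c in c.1]/c {1}Ecd -Ex xc.
have Ess : ss = ss'.
  by apply: (cword_segments (seg _ _ cf) _ Ew); rewrite Ew; apply: seg cf'.
apply/permP => x; have [c cs xc] := cf_mem cf x.
rewrite -(nextE (cf_cycle cf cs) xc) -(nextE (cf_cycle cf' _) xc) //.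
by rewrite -Ess.
Qed.

End Properties.

(** * Existence of cycle forms *)

Lemma index_lt_cat (T : eqType) (u v : seq T) (x y : T) :
  x \in u -> y \notin u -> index x (u ++ v) < index y (u ++ v).
Proof.
move=> xu yu; rewrite !index_cat xu (negPf yu).
by rewrite (leq_trans _ (leq_addr _ _)) // index_mem.
Qed.

Lemma pairwise_index (T : eqType) (w : seq T) : uniq w ->
  pairwise (fun x y => index x w < index y w) w.
Proof.
case: w => [//|x0 w] uw; apply/(pairwiseP x0) => i j iw jw ij.
by rewrite !index_uniq.
Qed.

Lemma heads_subseq (T : eqType) (ss : seq (T * seq T)) :
  subseq (map fst ss) (cword ss).
Proof.
elim: ss => //= c ss IH; rewrite eqxx.
exact: subseq_trans IH (suffix_subseq _ _).
Qed.

Section Existence.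
Variables (n : nat) (le : rel 'I_n).
Implicit Types (f : 'I_n -> nat) (s t : 'S_n) (ss : seq ('I_n * seq 'I_n)).

(* The levels are a rank function with minimal sum: a cycle without essential
   entry could be moved down by one level. *)
Lemma levels_exist t h : (forall x, h (t x) = h x) ->
    {homo h : x y / slt le x y >-> x < y} ->
  exists f, [/\ forall x, f (t x) = f x, {homo f : x y / slt le x y >-> x < y} &
                forall x, exists2 y, y \in porbit t x & ess le f y].
Proof.
have [m] := ubnP (\sum_x h x); elim: m h => // m IH h sz ht hm.
have hc x y : y \in porbit t x -> h y = h x by exact: porbit_const.
have [|] := boolP [forall x, exists y in porbit t x, ess le h y].
  by move=> /forallP he; exists h; split=> // x; apply/exists_inP.
rewrite negb_forall => /existsP[x0]; rewrite negb_exists => /forallP x0N.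
have Ness y : y \in porbit t x0 -> ~~ ess le h y.
  by move=> yx; have := x0N y; rewrite yx.
have h0 : 0 < h x0.
  by have := Ness _ (porbit_id t x0); rewrite negb_or -lt0n => /andP[].
pose h' x := if x \in porbit t x0 then (h x).-1 else h x.
apply: (IH h').
- rewrite (bigD1 x0) //= in sz; rewrite (bigD1 x0) //= {1}/h' porbit_id.
  have : \sum_(i | i != x0) h' i <= \sum_(i | i != x0) h i.
    by apply: leq_sum => i _; rewrite /h'; case: ifP => // _; apply: leq_pred.
  by move: sz h0; case: (h x0) => //= k sz _; lia.
- move=> x; rewrite /h' ht; congr (if _ then _ else _).
  by rewrite -!eq_porbit_mem (porbit_perm t 1 x).
move=> x y xy; have hxy := hm _ _ xy; rewrite /h'.
case: ifPn => [xO|xO]; case: ifPn => [yO|yO] //.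
- by move: hxy; rewrite (hc _ _ xO) (hc _ _ yO) ltnn.
- by rewrite (leq_ltn_trans _ hxy) // leq_pred.
(* Only [y] is lowered here. As [y] is not essential, [h x] is not [h y - 1], so there is room for
   the decrease. *)
have := Ness _ yO; rewrite negb_or negb_exists => /andP[_ /forallP/(_ x)].
by rewrite xy /=; lia.
Qed.

Lemma cycle_form_of_transverse t : t \in transverse_perms le ->
  exists f ss, cycle_form le t f ss.
Proof.
move=> /transverse_rank[h [ht hm]].
have [f [ft fm fe]] := levels_exist ht hm; exists f => {h ht hm}.
have fc x y : y \in porbit t x -> f y = f x by exact: porbit_const.
have orbE x y : (y \in fingraph.orbit t x) = (y \in porbit t x).
  apply/esym/porbit_cycle; last exact: in_orbit.
  by apply: cycle_orbit; apply: perm_inj.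
pose H x := ess le f x && [forall (y | y \in porbit t x), ess le f y ==>
  (y <= x)].
pose hs := sort (relpre (key f) leq) (enum H).
have hsE x : (x \in hs) = H x by rewrite mem_sort mem_enum.
have hs_uniq : uniq hs by rewrite sort_uniq enum_uniq.
have Hmax x y : H x -> y \in porbit t x -> ess le f y -> y <= x.
  by case/andP=> _ /forall_inP mx /mx/implyP; apply.
pose cyc_of h := (h, behead (fingraph.orbit t h)).
have cycE h : cseq (cyc_of h) = fingraph.orbit t h.
  by rewrite /cseq /cyc_of /= /fingraph.orbit -orderSpred.
exists (map cyc_of hs).
have cwE : cword (map cyc_of hs) = flatten (map (fingraph.orbit t) hs).
  by rewrite /cword -map_comp; congr flatten; apply: eq_map => h; apply: cycE.
split.
- rewrite cwE; apply: uniq_perm; rewrite ?enum_uniq //.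
    apply: uniq_flatten; first by apply/allP => _ /mapP[h _ ->];
      apply: orbit_uniq.
    rewrite pairwise_map; move: hs_uniq; rewrite uniq_pairwise.
    apply: (sub_in_pairwise (P := [in hs])); last exact: allss.
    (* Two heads in one orbit are both essential and bound each other, hence coincide. *)
    move=> a b; rewrite !hsE => Ha Hb /= aNb; apply/hasPn => y;
      rewrite /= !orbE.
    rewrite -!eq_porbit_mem => /eqP-> ; apply: contraNN aNb => /eqP Eba.
    have [ea eb] : ess le f a /\ ess le f b by case/andP: Ha; case/andP: Hb.
    apply/eqP/val_inj/eqP; rewrite eqn_leq (Hmax b a) ?(Hmax a b) //.
      by rewrite -eq_porbit_mem Eba.
    by rewrite -eq_porbit_mem -Eba.
  move=> x; rewrite mem_enum; apply/flatten_mapP.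
  (* The orbit of [x] has an essential entry, so a largest one exists and serves as head. *)
  have [y0 y0x ey0] := fe x.
  have [|h /andP[hx eh] hmax] := @arg_maxnP _ y0
      (fun y => (y \in porbit t x) && ess le f y) (@nat_of_ord n).
    by rewrite y0x.
  have Exh : porbit t x = porbit t h by apply/esym/eqP; rewrite eq_porbit_mem.
  exists h; last by rewrite orbE -Exh porbit_id.
  rewrite hsE /H eh; apply/forall_inP => y yh; apply/implyP => ey.
  by apply: hmax; rewrite Exh yh.
- exact: fm.
- move=> _ /mapP[h _ ->]; rewrite cycE.
  by apply: cycle_orbit; apply: perm_inj.
- move=> _ x /mapP[h _ ->] /mem_behead; rewrite /= orbE; exact: fc.
- by move=> _ /mapP[h + ->]; rewrite hsE => /andP[].
- move=> _ x /mapP[h + ->]; rewrite hsE => Hh xh ex /=.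
  rewrite ltn_neqAle Hmax ?andbT //; last by rewrite -orbE mem_behead.
  apply/eqP => /val_inj Exh; have := orbit_uniq t h.
  by move: xh; rewrite -cycE Exh /= => ->.
have -> : map fst (map cyc_of hs) = hs.
  by rewrite -map_comp -[RHS]map_id; apply: eq_map.
rewrite -(sorted_pairwise ltn_trans) ltn_sorted_uniq_leq.
rewrite map_inj_uniq //; last exact: key_inj.
rewrite hs_uniq sorted_map; apply: sort_sorted => a b; exact: leq_total.
Qed.

(** Each entry goes to its cyclic successor in its segment; [prev] undoes this. *)
Lemma perm_of_cycles ss : uniq (cword ss) -> (forall x, x \in cword ss) ->
  exists t : 'S_n, forall c, c \in ss -> fcycle t (cseq c).
Proof.
move=> uss memss.
pose seg x := nth (x, [::]) ss (find (fun c => x \in cseq c) ss).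
have segP x : seg x \in ss /\ x \in cseq (seg x).
  have hx : has (fun c => x \in cseq c) ss.
    by have /mem_cword[c cs xc] := memss x; apply/hasP; exists c.
  by split; [rewrite mem_nth // -has_find|apply: (nth_find (x, [::]) hx)].
have seg_uniq c : c \in ss -> uniq (cseq c).
  by move=> cs; apply: uniq_mem_flatten uss _; apply: map_f.
have tinj : injective (fun x => next (cseq (seg x)) x).
  move=> x y E; have {}E : next (cseq (seg x)) x = next (cseq (seg y)) y := E.
  have [sx xs] := segP x; have [sy ys] := segP y.
  have Es : seg x = seg y.
    apply: (cword_inj uss sx sy (x := next (cseq (seg x)) x)).
      by rewrite mem_next.
    by rewrite E mem_next.
  move: E; rewrite Es => /(congr1 (prev (cseq (seg y)))).
  by rewrite !prev_next // seg_uniq.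
exists (perm tinj) => c cs;
  rewrite -(@eq_in_cycle _ (mem (cseq c)) (frel (next (cseq c)))).
- by apply: cycle_next; apply: seg_uniq.
- move=> x y xc _ /=; rewrite permE; have [sx xs] := segP x.
  by rewrite (cword_inj uss cs sx xc xs).
by apply/allP.
Qed.

(** Cut the word before each left-to-right maximum and close the segments into cycles. No segment
    crosses a level, since the first entry of a level is essential, hence a maximum, and starts a
    segment. *)
Lemma cycle_form_of_linear_extension s : s \in linear_extensions le ->
  exists t f ss, cycle_form le t f ss /\ word s = cword ss.
Proof.
move=> ls; have pw := linear_extension_pairwise ls.
have uw := word_uniq s; have memw := mem_word s.
have [f gf] := graded_exists 0 uw pw.
set w := word s in pw uw memw gf *.
have [sw _ hw mw ew] := gf.
have [|ss Ess Hss] := @segments_exist _ (lrmax_at le f w) w.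
  case: (w) hw => // x v /= hx; rewrite /lrmax_at /= eqxx andbT.
  by rewrite /ess hx.
have [||t tc] := @perm_of_cycles ss; [by rewrite Ess|by move=> x; rewrite Ess|].
exists t, f, ss; split=> //.
have H1 c : c \in ss -> lrmax_at le f w c.1 by move/(allP Hss)=> /andP[].
have H2 c x : c \in ss -> x \in c.2 -> ~~ lrmax_at le f w x.
  by move/(allP Hss)=> /andP[_ /hasPn]; apply.
have ess1 c : c \in ss -> ess le f c.1 by move/H1=> /andP[].
(* Such an [x] is a left-to-right maximum, and a segment contains none besides its head. *)
have headP c x : c \in ss -> x \in cseq c -> ess le f x ->
    (forall y, y \in take (index x w) w -> f y = f x -> ess le f y -> y < x) ->
    x = c.1.
  move=> cs; rewrite inE => /predU1P[//|xc] ex mx.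
  have := H2 c x cs xc; rewrite /lrmax_at ex /= => /allPn[y yx].
  rewrite negb_imply => /andP[/andP[/eqP fy ey]].
  by rewrite mx.
have wE c : c \in ss -> exists p q, w = cword p ++ cseq c ++ cword q.
  by case/cword_split=> p [q [_ E]]; exists p, q; rewrite -Ess.
have index_le x y : index x w <= index y w -> f x <= f y.
  rewrite leq_eqVlt => /predU1P[/(congr1 (nth x w))|xy];
    first by rewrite !nth_index // => ->.
  have := (pairwiseP x sw) _ _ _ _ xy; rewrite !inE !index_mem !nth_index //.
  by apply.
have const c x : c \in ss -> x \in c.2 -> f x = f c.1.
  move=> cs xc; have [p [q Ew]] := wE c cs.
  have xcs : x \in cseq c by rewrite inE xc orbT.
  have notin y : y \in cseq c -> y \notin cword p.
    move=> yc; move: uw; rewrite Ew cat_uniq => /and3P[_ /hasPn h _].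
    by apply: h; rewrite mem_cat yc.
  have le_fx : f c.1 <= f x.
    apply: index_le; rewrite Ew !index_cat !(negPf (notin _ _)) ?mem_head //=.
    by rewrite eqxx leq_add2l.
  apply/eqP; rewrite eqn_leq le_fx andbT leqNgt; apply/negP => lt_fx.
  have : x \in [seq z <- w | f z == f x] by rewrite mem_filter eqxx memw.
  case Ez: [seq z <- w | _] => [//|z u] xz.
  have : z \in [seq z <- w | f z == f x] by rewrite Ez mem_head.
  rewrite mem_filter => /andP[/eqP fz zw].
  have z_first y : y \in take (index z w) w -> f y <> f x.
    move=> yz fy; have : y \in [seq z <- take (index z w) w | f z == f x].
      by rewrite mem_filter fy eqxx.
    by rewrite -take_index_filter ?fz // Ez /= eqxx take0.
  have ez : ess le f z.
    rewrite /ess fz; case Efx: (f x) => [|j] //=; rewrite Efx in Ez.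
    have [//|y _ /andP[fy yz]] := ew _ _ _ _ Ez.
    by apply/existsP; exists y; rewrite yz eqSS.
  have zH d : d \in ss -> z \in cseq d -> z = d.1.
    move=> ds zd; apply: (headP _ _ ds zd ez) => y yz fy _.
    by case: (z_first y yz); rewrite fy.
  (* Here [z] is the first entry of the level of [x]. Before the segment its level is at most that
     of [c.1]; inside it must be [c.1]; after it, [x] would come earlier. *)
  move: (zw); rewrite Ew !mem_cat => /or3P[zp|zc|zq].
  - have : f z <= f c.1.
      apply/index_le/ltnW; rewrite Ew; apply: index_lt_cat => //.
      by apply: notin; rewrite mem_head.
    by rewrite fz leqNgt lt_fx.
  - by move: lt_fx; rewrite -(zH c cs zc) fz ltnn.
  apply: (z_first x) => //; rewrite in_take // Ew catA.
  apply: index_lt_cat; first by rewrite mem_cat xcs orbT.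
  move: uw; rewrite Ew catA cat_uniq => /and3P[_ /hasPn h _].
  exact: h.
split.
- by rewrite Ess uniq_perm ?enum_uniq // => x; rewrite memw mem_enum.
- by move=> x y; apply: mw.
- exact: tc.
- exact: const.
- exact: ess1.
- move=> c x cs xc ex.
  (* The largest essential entry [y] of the segment is shown to be a left-to-right maximum, hence
     the head. *)
  have [|y /andP[yc ey] ymax] := @arg_maxnP _ c.1
      (fun y => (y \in cseq c) && ess le f y) (@nat_of_ord n).
    by rewrite mem_head ess1.
  have constP z : z \in cseq c -> f z = f c.1.
    by rewrite inE => /predU1P[->//|]; apply: const.
  have y_head : y = c.1.
    apply: (headP _ _ cs yc ey) => z zy fz ez; have [p [q Ew]] := wE c cs.
    have zw : z \in w by exact: mem_take zy.
    have zNy : index z w < index y w by rewrite -in_take.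
    move: (zw); rewrite Ew !mem_cat => /or3P[zp|zc|zq].
    + apply: (@leq_trans c.1); last by apply: ymax; rewrite mem_head ess1.
      have /andP[_ /allP h] := H1 c cs; have zt : z \in take (index c.1 w) w.
        rewrite Ew take_index_cat //; move: uw; rewrite Ew cat_uniq.
        by case/and3P=> _ /hasPn/(_ c.1) + _; rewrite mem_head; apply.
      by have /implyP := h z zt; apply; rewrite fz constP ?eqxx.
    + have zy' : z <= y by apply: ymax; rewrite zc.
      rewrite ltn_neqAle zy' andbT.
      by apply: contraTneq zNy => /val_inj->; rewrite ltnn.
    have : index y w < index z w.
      rewrite Ew catA; apply: index_lt_cat; first by rewrite mem_cat yc orbT.
      move: uw; rewrite Ew catA cat_uniq => /and3P[_ /hasPn h _].
      exact: h.
    by rewrite ltnNge ltnW.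
  have : x <= c.1 by rewrite -y_head; apply: ymax; rewrite inE xc orbT ex.
  rewrite leq_eqVlt => /predU1P[/val_inj Exc|//].
  have : uniq (cseq c).
    have uss : uniq (cword ss) by rewrite Ess.
    by apply: uniq_mem_flatten uss _; apply: map_f.
  by rewrite /= -Exc xc.
rewrite pairwise_map.
have : pairwise (fun a b =>
  (f a <= f b) && (index a w < index b w)) (map fst ss).
  apply: subseq_pairwise (heads_subseq ss) _; rewrite Ess.
  by rewrite pairwise_relI sw pairwise_index.
apply: (sub_in_pairwise (P := [in map fst ss])); last exact: allss.
move=> _ _ /mapP[c cs ->] /mapP[d ds ->] /andP[+ cd]; rewrite /= key_ltn.
rewrite leq_eqVlt orbC => /orP[-> //|fcd]; rewrite fcd /=; apply/orP; right.
(* At equal levels, [c.1] is an earlier essential entry than the maximum [d.1], hence smaller. *)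
have /andP[_ /allP/(_ c.1)] := H1 d ds.
by rewrite in_take // cd fcd ess1 //= => ->.
Qed.

(** A relation, so that both directions of the bijection reduce to existence and uniqueness. *)
Definition encodes t s := exists f ss, cycle_form le t f ss /\ word s = cword
  ss.

Lemma encodes_unique_l t t' s : encodes t s -> encodes t' s -> t = t'.
Proof.
move=> [f [ss [cf Ess]]] [f' [ss' [cf' Ess']]].
by apply: cf_perm_unique cf cf'; rewrite -Ess.
Qed.

Lemma encodes_unique_r t s s' : encodes t s -> encodes t s' -> s = s'.
Proof.
move=> [f [ss [cf Ess]]] [f' [ss' [cf' Ess']]].
by apply: word_inj; rewrite Ess Ess' (cf_cword_unique cf cf').
Qed.

Lemma transverse_bijection :
  exists Phi : {t : 'S_n | t \in transverse_perms le} ->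
               {s : 'S_n | s \in linear_extensions le},
    bijective Phi /\ forall u, cyc (val u) = LRmax le (val (Phi u)).
Proof.
have ex_s (t : {t : 'S_n | t \in transverse_perms le}) :
    exists s : {s : 'S_n | s \in linear_extensions le}, encodes (val t) (val s).
  have [f [ss cf]] := cycle_form_of_transverse (valP t).
  have [s Es] := word_exists (cf_perm cf).
  by exists (exist _ s (cf_linear_extension cf Es)), f, ss.
have ex_t (s : {s : 'S_n | s \in linear_extensions le}) :
    exists t : {t : 'S_n | t \in transverse_perms le}, encodes (val t) (val s).
  have [t [f [ss [cf Es]]]] := cycle_form_of_linear_extension (valP s).
  by exists (exist _ t (cf_transverse cf)), f, ss.
have [Phi PhiP] := choice ex_s; have [Psi PsiP] := choice ex_t.
exists Phi; split=> [|t].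
  exists Psi => [t|s]; apply: val_inj.
    exact: encodes_unique_l (PsiP (Phi t)) (PhiP t).
  exact: encodes_unique_r (PhiP (Psi s)) (PsiP s).
have [f [ss [cf Es]]] := PhiP t.
by rewrite (cf_cyc cf) (cf_LRmax cf Es).
Qed.

End Existence.

(** * Fixed spaces and the Moebius function *)

Import GRing.Theory Num.Theory.
Local Open Scope ring_scope.

Lemma memv_bigcap_seq (K : fieldType) (vT : vectType K) (s : seq {vspace vT}) (x
  : vT) :
  (x \in (\bigcap_(H <- s) H)%VS) = all (fun H : {vspace vT} => x \in H) s.
Proof.
elim: s => [|H s IH]; first by rewrite big_nil memvf.
by rewrite big_cons memv_cap IH.
Qed.

Lemma sum_pred1_seq (V : nmodType) (I : eqType) (r : seq I) (a : I) (P : pred I)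
    (F : I -> V) : uniq r -> a \in r -> P a ->
  \sum_(i <- r | P i && (a == i)) F i = F a.
Proof.
move=> ur ar Pa; rewrite (big_rem _ ar) Pa eqxx /= big1_seq ?addr0 // => i.
by rewrite mem_rem_uniq // !inE => /andP[/andP[_ /eqP->]]; rewrite eqxx.
Qed.

Section FixedSpaces.
Variables (R : realType) (n : nat).
Implicit Types (t : 'S_n) (X : {vspace 'rV[R]_n}).

(** For a fixed point [i] of [t] the factor [hyperplane R i i] is the whole space. *)
Definition fixspace t : {vspace 'rV[R]_n} :=
  (\bigcap_(H <- [seq hyperplane R i (t i) | i <- enum 'I_n]) H)%VS.

Lemma memv_fixspace t (x : 'rV[R]_n) :
  reflect (forall i, x 0 (t i) = x 0 i) (x \in fixspace t).
Proof.
rewrite memv_bigcap_seq all_map; apply: (iffP allP) => [xt i|xt i _] /=.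
  by have := xt i (mem_enum _ i); rewrite /= memv_hyperplane => /eqP.
by rewrite memv_hyperplane xt.
Qed.

Lemma memv_fixspace_porbit t (x : 'rV[R]_n) i j : x \in fixspace t ->
  j \in porbit t i -> x 0 j = x 0 i.
Proof. by move=> /memv_fixspace; apply: (porbit_const (h := x 0)). Qed.

(** Take all braid hyperplanes containing the space. Since [braid] lists each with the smaller index
    first, [t i < i] and [i < t i] are treated separately. *)
Lemma fixspace_flat t : fixspace t \in flats R n.
Proof.
pose B : {fset {vspace 'rV[R]_n}} := [fset H in braid R n | (fixspace t <=
  H)%VS]%fset.
apply/imfsetP; exists B; first by rewrite /= fpowersetE; apply/fsubsetP => H;
  rewrite !inE => /andP[].
apply/vspaceP => x; rewrite [RHS]memv_bigcap_seq; apply/idP/allP => [xt H|xB].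
  by rewrite !inE => /andP[_ /subvP]; apply.
apply/memv_fixspace => i.
have fix_le j k : (j == t k) || (k == t j) ->
  (fixspace t <= hyperplane R j k)%VS.
  move=> jk; apply/subvP => y /memv_fixspace yt; rewrite memv_hyperplane.
  by case/orP: jk => /eqP->; rewrite yt.
have inB (j k : 'I_n) : (j < k)%N -> (j == t k) || (k == t j) -> x 0 j = x 0 k.
  move=> jk /fix_le le_jk; apply/eqP; rewrite -memv_hyperplane; apply: xB.
  rewrite !inE le_jk andbT; apply/imfsetP; exists (j, k) => //=.
  by rewrite inE.
case: (ltngtP (t i) i) => [lt_ti|lt_ti|/val_inj-> //].
  by apply: inB; rewrite ?eqxx.
by symmetry; apply: inB; rewrite ?eqxx ?orbT.
Qed.

Lemma flat_fullv_or_hyperplane X : X \in flats R n ->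
  X = fullv \/ exists i j : 'I_n, i != j /\ (X <= hyperplane R i j)%VS.
Proof.
case/imfsetP => /= B; rewrite fpowersetE => /fsubsetP sB ->.
case: (fset_0Vmem B) => [->|[H HB]]; first by left; rewrite big_nil.
right; have /imfsetP[[i j] /=] := sB H HB; rewrite inE /= => ij EH.
exists i, j; split; first by rewrite neq_ltn ij.
by apply/subvP => x; rewrite memv_bigcap_seq => /allP/(_ H HB); rewrite EH.
Qed.

(** Vectors constant on cycles are the injective image, under [g], of vectors indexed by the cycles;
    [rk] numbers the cycles and [rep] picks representatives. *)
Lemma dim_fixspace t : \dim (fixspace t) = cyc t.
Proof.
have oP i : porbit t i \in porbits t by apply: imset_f.
pose rk i : 'I_#|porbits t| := enum_rank_in (oP i) (porbit t i).
have rkE i j : (rk i == rk j) = (j \in porbit t i).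
  rewrite -eq_porbit_mem eq_sym; apply/eqP/eqP => [/(congr1 enum_val)|E].
    by rewrite !enum_rankK_in.
  by apply: enum_val_inj; rewrite !enum_rankK_in.
have /choice[rep repP] : forall k, exists i, rk i = k.
  move=> k; have /imsetP[i _ Ek] := enum_valP k; exists i.
  by apply: enum_val_inj; rewrite enum_rankK_in.
pose g := linfun (colsub rk : 'rV[R]_#|porbits t| -> 'rV[R]_n).
have gE y i : g y 0 i = y 0 (rk i) by rewrite lfunE mxE.
have -> : fixspace t = limg g.
  apply/vspaceP => x; apply/idP/memv_imgP => [xt|[y _ ->]].
    exists (\row_k x 0 (rep k)); rewrite ?memvf //.
    apply/rowP => i; rewrite gE mxE; apply: (memv_fixspace_porbit xt).
    by rewrite -rkE repP.
  apply/memv_fixspace => i; rewrite !gE; congr (y 0 _); apply/eqP.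
  by rewrite rkE -eq_porbit_mem (porbit_perm t 1).
rewrite limg_dim_eq; first by rewrite dimvf dim_matrix mul1r.
apply/eqP; rewrite -subv0; apply/subvP => y; rewrite memv_cap memv_ker memv0.
case/andP=> _ /eqP gy; apply/eqP/rowP => k.
by rewrite -(repP k) -gE gy !mxE.
Qed.

Lemma codim_fixspace t : codim (fixspace t) = (n - cyc t)%N.
Proof. by rewrite /codim dim_fixspace. Qed.

Lemma sign_perm_codim t : (-1) ^+ t = (-1) ^+ codim (fixspace t) :> int.
Proof.
have le_cyc : (cyc t <= n)%N.
  by rewrite /cyc (leq_trans (leq_imset_card _ _)) // card_ord.
rewrite codim_fixspace -[RHS]signr_odd oddB //.
(* [odd_perm] is by definition this comparison of parities. *)
by rewrite [odd_perm t]/(odd #|'I_n| (+) odd (cyc t)) card_ord.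
Qed.

Lemma fixspace_eq_fullv t : (fixspace t == fullv) = (t == 1%g).
Proof.
apply/eqP/eqP => [tV|->]; last first.
  by apply/vspaceP => x; rewrite memvf; apply/memv_fixspace => i; rewrite perm1.
apply/permP => i; rewrite perm1; apply/eqP; apply/negPn/negP => tNi.
(* The basis vector at [i] separates the coordinates [i] and [t i]. *)
have /memv_fixspace/(_ i) : delta_mx 0 i \in fixspace t by rewrite tV memvf.
by rewrite !mxE !eqxx (negPf tNi) /= => /eqP; rewrite eq_sym oner_eq0.
Qed.

(* Multiplication by the transposition of a hyperplane containing [X] pairs
   the permutations of opposite signs. *)
Lemma sum_sign_fixspace X : X \in flats R n -> X != fullv ->
  \sum_(t : 'S_n | (X <= fixspace t)%VS) (-1) ^+ t = 0 :> int.
Proof.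
move=> XF; have [->|[i [j [ij /subvP Xij]]] _] := flat_fullv_or_hyperplane XF.
  by rewrite eqxx.
have fixM t : (X <= fixspace (t * tperm i j)%g)%VS = (X <= fixspace t)%VS.
  have xij x k : x \in X -> x 0 (tperm i j k) = x 0 k.
    move=> /Xij; rewrite memv_hyperplane => /eqP xE.
    by case: tpermP => [->|->|] //.
  apply/subvP/subvP => Xt x xX; apply/memv_fixspace => k.
    by have /memv_fixspace/(_ k) := Xt x xX; rewrite permM xij.
  by rewrite permM xij //; have /memv_fixspace := Xt x xX.
set S := LHS; suff : S = - S by lia.
rewrite {1}/S (reindex_inj (mulIg (tperm i j))) -sumrN.
apply: eq_big => [t|t _]; first exact: fixM.
by rewrite odd_permM odd_tperm ij signr_addb mulrN1.
Qed.

(** Both sides satisfy the same recursion, by [sum_sign_fixspace]; the induction is on codimension,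
    smaller for flats strictly containing [X]. *)
Lemma mobius_flats X : X \in flats R n ->
  mobius (@flat_le R n) (flats R n) fullv X =
  \sum_(t : 'S_n | fixspace t == X) (-1) ^+ t.
Proof.
have [m] := ubnP (codim X); elim: m X => // m IH X cX XF.
rewrite mobiusE //; last 2 first.
- by move=> Y Z /= YZ; apply/eqP; rewrite eqEsubv andbC.
- by move=> Y Z W YZ WY; apply: subv_trans WY YZ.
rewrite /flat_le subvf eq_sym; case: eqVneq => [->|XV].
  by rewrite (big_pred1 1%g) ?odd_perm1 // => t; rewrite fixspace_eq_fullv.
have -> : \sum_(Z <- flats R n | [&& (Z <= fullv)%VS, (X <= Z)%VS & Z != X])
    mobius (@flat_le R n) (flats R n) fullv Z =
  \sum_(Z <- flats R n | (X <= Z)%VS && (Z != X))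
    \sum_(t : 'S_n | fixspace t == Z) (-1) ^+ t.
  rewrite big_seq_cond [RHS]big_seq_cond; apply: eq_big => Z;
    first by rewrite subvf.
  case/and3P=> ZF _ /andP[XZ ZX]; apply: IH => //.
  have : (\dim X < \dim Z)%N by rewrite (ltn_leqif (dimv_leqif_eq XZ)) eq_sym.
  have : (\dim Z <= n)%N by rewrite (leq_trans (dimvS (subvf Z))) // dimvf
    dim_matrix mul1r.
  by move: cX; rewrite /codim; lia.
(* Each [t] contributes for exactly one flat, its fixed space. *)
rewrite (exchange_big_dep (fun t =>
  (X <= fixspace t)%VS && (fixspace t != X))) /=; last first.
  by move=> Z t + /eqP->.
rewrite (eq_bigr (fun t : 'S_n => (-1) ^+ t)); last first.
  move=> t Xt; rewrite (sum_pred1_seq (P := fun Z =>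
    (X <= Z)%VS && (Z != X))) //.
    exact: fset_uniq.
  exact: fixspace_flat.
have := sum_sign_fixspace XF XV; rewrite (bigID (fun t => fixspace t == X)) /=.
rewrite (eq_bigl (fun t => fixspace t == X)); last first.
  by move=> t; rewrite andb_idl // => /eqP->.
by move/eqP; rewrite addr_eq0 => /eqP.
Qed.

Lemma norm_mobius_flats X : X \in flats R n ->
  `|mobius (@flat_le R n) (flats R n) fullv X| =
  \sum_(t : 'S_n | fixspace t == X) 1 :> int.
Proof.
move=> XF; rewrite mobius_flats //.
rewrite (eq_bigr (fun=> (-1) ^+ codim X * 1)); last first.
  by move=> t /eqP<-; rewrite sign_perm_codim mulr1.
by rewrite -mulr_sumr normrMsign ger0_norm // sumr_ge0.
Qed.

(** * The Poincaré polynomial as a sum over transverse permutations *)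

Variable le : rel 'I_n.

(** A cone point fixed by [t] is a strictly monotone function constant on cycles; conversely a rank
    function on the cycles gives such a point. *)
Lemma fixspace_interior t :
  (fixspace t \in interior_flats R le) = (t \in transverse_perms le).
Proof.
have -> : (fixspace t \in interior_flats R le) =
    `[< ([set` fixspace t] `&` @cone R n le !=set0)%classic >].
  by rewrite !inE fixspace_flat.
apply/asboolP/idP => [[x [/= xt xK]]|tT].
  apply: (@transverse_monotone _ _ _ _ (fun i => x 0 i)) => [i|i j ij].
    by move/memv_fixspace: xt.
  exact: xK.
have [h [ht hm]] : exists h : 'I_n -> nat,
    (forall x, h (t x) = h x) /\ {homo h : x y / slt le x y >-> (x < y)%N}.
  exact: transverse_rank.
exists (\row_i (h i)%:R); split=> /=.
  by apply/memv_fixspace => i; rewrite !mxE ht.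
by move=> i j /hm; rewrite !mxE ltr_nat.
Qed.

Lemma Poin_transverse :
  Poin R le = \sum_(t in transverse_perms le) 'X^(n - cyc t).
Proof.
rewrite /Poin /whitney.
have codim_le X : (codim X < n.+1)%N by rewrite ltnS leq_subr.
transitivity (\sum_(X <- interior_flats R le)
    (\sum_(t : 'S_n | fixspace t == X) 1 : int) *: 'X^(codim X) : {poly int}).
  under eq_bigr => k _ do rewrite scaler_suml.
  rewrite (exchange_big_dep predT) //=; rewrite big_seq [RHS]big_seq.
  apply: eq_bigr => X; rewrite inE => /andP[XF _].
  by rewrite (big_pred1 (Ordinal (codim_le X))) ?norm_mobius_flats //.
under eq_bigr => X _ do rewrite scaler_suml.
rewrite (exchange_big_dep predT) //= [RHS]big_mkcond.
apply: eq_bigr => t _; rewrite -fixspace_interior.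
case: ifPn => [tI|tN].
  rewrite (sum_pred1_seq (P := predT)) ?fset_uniq // scale1r.
  by rewrite codim_fixspace.
by rewrite big1_seq // => X /andP[/= /eqP<- tI]; rewrite tI in tN.
Qed.

End FixedSpaces.

Theorem theorem1p2 (R : realType) (n : nat) (le : rel 'I_n)
    (le_refl : reflexive le) (le_anti : antisymmetric le)
    (le_trans : transitive le) :
  (exists Phi : {t : 'S_n | t \in transverse_perms le} ->
                {s : 'S_n | s \in linear_extensions le},
     bijective Phi /\ forall t, cyc (val t) = LRmax le (val (Phi t))) /\
  Poin R le = \sum_(s in linear_extensions le) 'X^(n - LRmax le s).
Proof.
(* Sums over a set become sums over the subtype, on which [Phi] can reindex. *)
have sum_sub (A : {set 'S_n}) (F : 'S_n -> {poly int}) :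
    \sum_(t in A) F t = \sum_(u : {t : 'S_n | t \in A}) F (val u).
  rewrite (reindex_omap val (insub : 'S_n -> option {t : 'S_n | t \in A})) /=.
    by apply: eq_bigl => u; rewrite (valP u) valK eqxx.
  by move=> t tA; rewrite insubT.
have [Phi [Phi_bij PhiE]] := transverse_bijection le.
split; first by exists Phi.
rewrite Poin_transverse !sum_sub (reindex Phi); last exact: onW_bij.
by apply: eq_bigr => u _; rewrite PhiE.
Qed.
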